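(* Let $H$ be a star hypergraph, uniform of rank $k$, on the vertex set $\{1,\dots,n\}$. For $n-k-1\ge r\ge -1$, $$\dim HC_r(\Delta(H))=\binom{n-k+1}{r+1}.$$
   Context: All vector spaces are over a fixed field of characteristic zero. A hypergraph $H=(V,E)$ consists of a vertex set $V=\{1,\dots,n\}$ and a set $E$ of subsets of $V$ (hyperedges). It is uniform of rank $k$ if all its hyperedges have size $k$. A star hypergraph is a uniform hypergraph of rank $k$ with no singleton vertices (every vertex lies in some hyperedge) such that all of its hyperedges intersect in a common set of size $k-1$. For $r\ge -1$ consider ordered set partitions $(B_1,\dots,B_{r+2})$ of $\{1,\dots,n\}$ into nonempty blocks, at least one of which contains a hyperedge of $H$, modulo the signed cyclic relation $(B_1,\dots,B_{r+2})\sim(-1)^{r+1}(B_{\sigma(1)},\dots,B_{\sigma(r+2)})$, where $\sigma=(1,2,\dots,r+2)$ is the cyclic permutation. The class is written $[B_1,\dots,B_{r+2}]$ and is represented by the unique representative with $1\in B_1$. Let $C_r$ be the vector space with basis these classes $[B_1,\dots,B_{r+2}]$ with $1\in B_1$, and let $$\partial_r([B_1,\dots,B_{r+2}])=\sum_{i=1}^{r+1}(-1)^{i+1}[B_1,\dots,B_i\cup B_{i+1},\dots,B_{r+2}]+(-1)^{r+3}[B_1\cup B_{r+2},B_2,\dots,B_{r+1}]$$ for $r\ge 0$, and $\partial_{-1}=0$. The cyclic coloring complex $\Delta(H)$ is the chain complex $(C_r,\partial_r)$, and $HC_r(\Delta(H))=\ker\partial_r/\operatorname{im}\partial_{r+1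}$.
   Formalization: The rank is assumed to be k ≥ 2; for k = 1 the claim fails, e.g. n = 2 with hyperedges {1},{2} and r = 0, where C_0 has dimension 1 but the binomial coefficient is 2. *)

(* Defs.v *)
(* Mathematical Components *)
From HB Require Import structures.
From mathcomp Require Import all_boot all_order all_algebra.

Set Implicit Arguments.
Unset Strict Implicit.
Unset Printing Implicit Defensive.

Import Order.TTheory GRing.Theory Num.Theory.
Local Open Scope quotient_scope.
Local Open Scope ring_scope.

(* The quotient space U / (U :&: W) of a subspace U of a vector space; this is
   U / W as soon as W <= U. The underlying additive group is the quotient
   Quotient.quot of the library by the subgroup vquot_sub of U. *)
Section VectorQuotient.
Import VectorInternalTheory.
Variables (K : fieldType) (V : vectType K) (U W : {vspace V}).

Definition vquot_sub : {pred subvs_of U} := fun x => vsval x \in W.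

Fact vquot_sub_zmod_closed : zmod_closed vquot_sub.
Proof.
split=> [|x y xW yW]; first exact: mem0v.
exact: (rpredB xW yW).
Qed.

HB.instance Definition _ :=
  GRing.isZmodClosed.Build (subvs_of U) vquot_sub vquot_sub_zmod_closed.

Definition vquot : Type := Quotient.quot vquot_sub.
HB.instance Definition _ := GRing.Zmodule.on vquot.

Definition vquot_pi (x : subvs_of U) : vquot := \pi_(Quotient.quot vquot_sub) x.

Definition vquot_scale (a : K) (q : vquot) : vquot :=
  vquot_pi (a *: repr (q : Quotient.quot vquot_sub)).

Lemma vquot_piP x y : reflect (vquot_pi x = vquot_pi y) (vsval (x - y) \in W).
Proof.
by rewrite -[_ \in W]/(x - y \in vquot_sub) Quotient.idealrBE; apply/eqP.
Qed.

Lemma vquot_piK (q : vquot) : vquot_pi (repr (q : Quotient.quot vquot_sub)) = q.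
Proof. exact: reprK. Qed.

Lemma vquot_repr x :
  vsval (repr (vquot_pi x : Quotient.quot vquot_sub)) - vsval x \in W.
Proof. by rewrite -linearB; apply/vquot_piP; rewrite vquot_piK. Qed.

Lemma vquot_piD x y : vquot_pi (x + y) = vquot_pi x + vquot_pi y.
Proof. exact: raddfD. Qed.

Lemma vquot_piZ a x : vquot_scale a (vquot_pi x) = vquot_pi (a *: x).
Proof. by apply/vquot_piP; rewrite -scalerBr linearZ memvZ // linearB vquot_repr. Qed.

Fact vquot_scaleA a b q :
  vquot_scale a (vquot_scale b q) = vquot_scale (a * b) q.
Proof. by rewrite -[q]vquot_piK !vquot_piZ scalerA. Qed.

Fact vquot_scale1 : left_id 1 vquot_scale.
Proof. by move=> q; rewrite -[q]vquot_piK vquot_piZ scale1r. Qed.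

Fact vquot_scaleDr : right_distributive vquot_scale +%R.
Proof.
move=> a p q; rewrite -[p]vquot_piK -[q]vquot_piK -vquot_piD !vquot_piZ.
by rewrite scalerDr vquot_piD.
Qed.

Fact vquot_scaleDl q : {morph vquot_scale^~ q : a b / a + b}.
Proof.
by move=> a b; rewrite -[q]vquot_piK !vquot_piZ scalerDl vquot_piD.
Qed.

HB.instance Definition _ := GRing.Zmodule_isLmodule.Build K vquot
  vquot_scaleA vquot_scale1 vquot_scaleDr vquot_scaleDl.

Fact vquot_pi_is_linear : linear vquot_pi.
Proof. by move=> a x y; rewrite vquot_piD -vquot_piZ. Qed.

HB.instance Definition _ :=
  GRing.isLinear.Build K (subvs_of U) vquot _ vquot_pi vquot_pi_is_linear.

Fact vquot_vect_iso : Vector.axiom (\dim (U :\: W)) vquot.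
Proof.
have p1in u : addv_pi1 U W u \in (U :\: W)%VS by exact: memv_pi.
have p1id u : u \in (U :\: W)%VS -> addv_pi1 U W u = u.
  by apply: daddv_pi_id; exact: capv_diff.
pose g (u : V) := v2r (vsproj (U :\: W) (addv_pi1 U W u)).
have gB u v : g (u - v) = g u - g v by rewrite /g !linearB.
have g0 u : u \in U -> (g u == 0) = (u \in W).
  move=> uU; have uUW : u \in (U + W)%VS by rewrite (subvP (addvSl U W)).
  have -> : (g u == 0) = (addv_pi1 U W u == 0).
    rewrite /g -[X in _ == X](linear0 v2r) (inj_eq (can_inj v2rK)).
    by rewrite -(inj_eq val_inj) /= vsprojK.
  have puE := addv_pi1_pi2 uUW.
  apply/eqP/idP => [p0|uW]; first by rewrite -puE p0 add0r; exact: memv_pi.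
  by apply: (addIr u); rewrite add0r -{2}(addv_pi2_id U uW).
pose f (q : vquot) := g (vsval (repr (q : Quotient.quot vquot_sub))).
have fpi x : f (vquot_pi x) = g (vsval x).
  apply/eqP; rewrite -subr_eq0 -gB g0; first exact: vquot_repr.
  by rewrite rpredB ?subvsP.
have hU (w : subvs_of (U :\: W)) : vsval w \in U.
  by rewrite (subvP (diffvSl U W)) ?subvsP.
exists f => [a p q|].
  rewrite -[p]vquot_piK -[q]vquot_piK -linearP !fpi.
  by rewrite /g !linearP.
exists (fun r => vquot_pi (Subvs (hU (r2v r)))) => [q|r]; last first.
  by rewrite fpi /g /= p1id ?subvsP // vsvalK r2vK.
rewrite -[RHS]vquot_piK; apply/vquot_piP.
rewrite -g0 ?subvsP // linearB gB subr_eq0 /= /f {1}/g v2rK vsprojK //.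
by rewrite p1id.
Qed.

HB.instance Definition _ :=
  Lmodule_hasFinDim.Build K vquot vquot_vect_iso.

Lemma dim_vquot : \dim {: vquot} = \dim (U :\: W).
Proof. exact: dimvf. Qed.

End VectorQuotient.

(* A hypergraph on n vertices is its set of hyperedges E : {set {set 'I_n}}; the
   vertices 1, ..., n are the elements of 'I_n, so vertex 1 has value 0. *)
Section Hypergraphs.
Variables (n k : nat) (E : {set {set 'I_n}}).

Definition uniform_rank : Prop := forall e, e \in E -> #|e| = k.

(* The common set has size k - 1. Only its inclusion in every hyperedge is
   asked for, so the hypergraph with a single hyperedge is a star. *)
Definition star_hypergraph : Prop :=
  [/\ uniform_rank,
      forall v : 'I_n, exists2 e, e \in E & v \in e
    & exists2 S : {set 'I_n}, #|S|.+1 = k & forall e, e \in E -> S \subset e].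

End Hypergraphs.

Section CyclicColoringComplex.
Variables (F : fieldType) (n : nat) (E : {set {set 'I_n}}).

Definition ordered_set_partition (s : seq {set 'I_n}) : bool :=
  uniq s && partition [set:: s] [set: 'I_n].

Definition some_block_has_edge (s : seq {set 'I_n}) : bool :=
  has (fun B : {set 'I_n} => [exists e in E, e \subset B]) s.

Definition vertex1_in_first (s : seq {set 'I_n}) : bool :=
  [exists v in head set0 s, val v == 0%N].

(* The classes [B_1, ..., B_m], each given by its representative with 1 in B_1.
   As the blocks are distinct, the m rotations of an ordered partition are
   distinct, and exactly one of them has 1 in its first block. *)
Record cyc_class (m : nat) := CycClass {
  blocks :> m.-tuple {set 'I_n};
  _ : [&& ordered_set_partition blocks, some_block_has_edge blocks
        & vertex1_in_first blocks] }.

HB.instance Definition _ m := [isSub for @blocks m].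
HB.instance Definition _ m := [Finite of cyc_class m by <:].

(* The indices are numbers of blocks: chain m is C_(m - 2). *)
Definition chain (m : nat) : vectType F := {ffun cyc_class m -> F^o}.

(* The basis vector of the class s; it is 0 if s represents no class. *)
Definition class_vect (m : nat) (s : seq {set 'I_n}) : chain m :=
  [ffun t : cyc_class m => (blocks t == s :> seq _)%:R].

(* (B_1, ..., B_i :|: B_(i + 1), ..., B_m), with i counted from 0 *)
Definition merge_at (i : nat) (s : seq {set 'I_n}) : seq {set 'I_n} :=
  take i s ++ (nth set0 s i :|: nth set0 s i.+1) :: drop i.+2 s.

(* (B_1 :|: B_m, B_2, ..., B_(m - 1)) *)
Definition merge_ends (s : seq {set 'I_n}) : seq {set 'I_n} :=
  (head set0 s :|: last set0 s) :: behead (take (size s).-1 s).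

(* In terms of r = m - 1, the sum is over 1 <= i.+1 <= r + 1 with sign
   (-1)^((i + 1) + 1), and the last sign is (-1)^(r + 3). *)
Definition boundary_class (m : nat) (s : cyc_class m.+1) : chain m :=
  \sum_(i < m) (-1) ^+ i.+2 *: class_vect m (merge_at i s)
  + (-1) ^+ m.+2 *: class_vect m (merge_ends s).

Definition boundary_fun (m : nat) (x : chain m.+1) : chain m :=
  \sum_(s : cyc_class m.+1) (x : {ffun _ -> F^o}) s *: boundary_class s.

Fact boundary_fun_is_linear m : linear (@boundary_fun m).
Proof.
move=> a x y; rewrite /boundary_fun scaler_sumr -big_split /=.
by apply: eq_bigr => s _; rewrite !ffunE scalerDl scalerA.
Qed.

HB.instance Definition _ m := GRing.isLinear.Build F (chain m.+1) (chain m) _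
  (@boundary_fun m) (@boundary_fun_is_linear m).

(* boundary m is the boundary map C_(m - 1) -> C_(m - 2). *)
Definition boundary (m : nat) : 'Hom(chain m.+1, chain m) :=
  linfun (@boundary_fun m).

(* No class has 0 blocks, so chain 0 = 0 and the boundary map on C_(-1) is 0. *)
Lemma cyc_class0 (s : cyc_class 0) : False.
Proof.
case: s => s /and3P[_ _].
by rewrite tuple0 => /existsP[v]; rewrite inE.
Qed.

Lemma boundary0 : boundary 0 = 0.
Proof. by apply/lfunP => x; apply/ffunP => s; case: (cyc_class0 s). Qed.

(* HC_r = ker (C_r -> C_(r-1)) / im (C_(r+1) -> C_r), for r >= -1 *)
Definition HC (r : int) : vectType F :=
  let m := `|(r + 1)%R|%N in vquot (lker (boundary m)) (limg (boundary m.+1)).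

End CyclicColoringComplex.

(* Main.v *)
Require Import Defs.
From HB Require Import structures.
From mathcomp Require Import all_boot all_order all_algebra.
From mathcomp Require Import all_fingroup zify.

(* A star hypergraph with centre S has exactly the hyperedges S + v, v in
   W := ~: S, so a class with a block containing a hyperedge is an ordered
   partition of W into nonempty blocks, the first one being attached to S. This
   is the multilinear part, with nonempty first block, of the Hochschild complex
   of the polynomial ring on W.

   Upper bound: the classes are matched in pairs, by splitting off or merging
   back the least vertex of the first block that is not a singleton (as in the
   resolution of the exterior algebra from the bar complex). A weight that
   counts inversions makes the matched part of the boundary triangular, and the
   unmatched classes, whose blocks beyond the first are decreasing singletons,
   correspond to the r+1-subsets of W.

   Lower bound: each such subset T gives the cycle obtained by antisymmetrizing
   the class with singleton blocks T, and a cocycle, a cup product of degree 1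
   classes; the two families are dual to each other. *)

Set Implicit Arguments.
Unset Strict Implicit.
Unset Printing Implicit Defensive.

Import Order.TTheory GRing.Theory Num.Theory.
Local Open Scope ring_scope.

(** * Vector spaces with a basis *)

Section FreeVectorSpaces.
Variable F : fieldType.

Definition freev (A : finType) : vectType F := {ffun A -> F^o}.

Definition bvec (A : finType) (a : A) : freev A :=
  [ffun x => (x == a)%:R].

Lemma freev_decomp (A : finType) (x : freev A) :
  x = \sum_a (x : {ffun _ -> F^o}) a *: bvec a.
Proof.
apply/ffunP => b; rewrite sum_ffunE (bigD1 b) //= big1 => [|a ab].
  by rewrite !ffunE eqxx addr0 [RHS]mulr1.
by rewrite !ffunE eq_sym (negPf ab) [LHS]mulr0.
Qed.

Lemma dim_freev (A : finType) : \dim {: freev A} = #|A|.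
Proof. by rewrite dimvf /dim /= muln1. Qed.

Lemma lfun_bvecP (A : finType) (U : vectType F) (f g : 'Hom(freev A, U)) :
  (forall a, f (bvec a) = g (bvec a)) -> f = g.
Proof.
move=> fg; apply/lfunP => x; rewrite (freev_decomp x) !linear_sum /=.
by apply: eq_bigr => a _; rewrite !linearZ /= fg.
Qed.

Definition linext_fun (A : finType) (U : vectType F) (f : A -> U)
    (x : freev A) : U := \sum_a (x : {ffun _ -> F^o}) a *: f a.

Fact linext_fun_is_linear (A : finType) (U : vectType F) (f : A -> U) :
  linear (linext_fun f).
Proof.
move=> a x y; rewrite /linext_fun scaler_sumr -big_split /=.
by apply: eq_bigr => s _; rewrite !ffunE scalerDl scalerA.
Qed.

HB.instance Definition _ (A : finType) (U : vectType F) (f : A -> U) :=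
  GRing.isLinear.Build F (freev A) U _ (linext_fun f) (linext_fun_is_linear f).

Definition linext (A : finType) (U : vectType F) (f : A -> U) :
  'Hom(freev A, U) := linfun (linext_fun f).

Lemma linext_bvec (A : finType) (U : vectType F) (f : A -> U) a :
  linext f (bvec a) = f a.
Proof.
rewrite lfunE /= /linext_fun (bigD1 a) //= big1 => [|b ba].
  by rewrite ffunE eqxx scale1r addr0.
by rewrite ffunE (negPf ba) scale0r.
Qed.

Lemma linext_bij (A B : finType) (h : A -> B) (e : A -> F) :
  bijective h -> (forall a, e a != 0) ->
  let f := linext (fun a => e a *: bvec (h a)) in
  lker f = 0%VS /\ limg f = fullv.
Proof.
move=> [h' hK h'K] e0 f.
pose f' := linext (fun b => (e (h' b))^-1 *: bvec (h' b)).
have ff' : (f \o f')%VF = \1%VF.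
  apply: lfun_bvecP => b; rewrite comp_lfunE linext_bvec linearZ /= /f linext_bvec.
  by rewrite h'K scalerA mulVf ?e0 // scale1r lfunE.
have f'f : (f' \o f)%VF = \1%VF.
  apply: lfun_bvecP => b; rewrite comp_lfunE linext_bvec linearZ /= /f' linext_bvec.
  by rewrite hK scalerA mulfV ?e0 // scale1r lfunE.
split.
  apply/eqP/lker0P => x y fxy.
  by rewrite -[x]id_lfunE -[y]id_lfunE -f'f !comp_lfunE fxy.
apply/eqP; rewrite eqEsubv subvf /=; apply/subvP => x _.
by rewrite -[x]id_lfunE -ff' comp_lfunE memv_img ?memvf.
Qed.

(* Solving f x = c e_a + (lower and non-pivot terms) for e_a shows that the
   image of f and the non-pivot basis vectors together span the target. *)
Lemma card_pivots_le_rank (A : finType) (V : vectType F)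
    (f : 'Hom(V, freev A)) (U : pred A) (w : A -> nat) :
  (forall a, U a -> exists (x : V) (c : F), c != 0 /\ f x - c *: bvec a \in
     <<[seq bvec b | b in [pred b | ~~ U b || (w b < w a)%N]]>>%VS) ->
  (#|U| <= \dim (limg f))%N.
Proof.
move=> piv.
pose N : {vspace freev A} := <<[seq bvec b | b in [pred b | ~~ U b]]>>%VS.
suff full : (fullv <= limg f + N)%VS.
  have := leq_trans (dimvS full) (dimv_add_leqif (limg f) N).
  rewrite dim_freev -(cardC U) => le_dim.
  rewrite -(leq_add2r #|[predC U]|) (leq_trans le_dim) //.
  by rewrite leq_add2l (leq_trans (dim_span _)) // size_map -cardE.
have inN b : ~~ U b -> bvec b \in N.
  by move=> nUb; rewrite memv_span //; apply/imageP; exists b.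
suff all_in m a : (w a < m)%N -> bvec a \in (limg f + N)%VS.
  apply/subvP => x _; rewrite (freev_decomp x) memv_suml // => a _.
  by rewrite memvZ // (all_in (w a).+1).
elim: m a => // m IH a wa.
have [Ua|nUa] := boolP (U a); last first.
  by rewrite -[bvec a]add0r memv_add ?mem0v ?inN.
have [x [c [c0 fx]]] := piv a Ua.
rewrite -[bvec a]scale1r -(mulVf c0) -scalerA memvZ //.
rewrite -[c *: _](subKr (f x)) rpredB //.
  by rewrite -[f x]addr0 memv_add ?mem0v ?memv_img ?memvf.
apply: subvP fx; apply/span_subvP => _ /imageP[b /orP[nUb|wb] ->].
  by rewrite -[bvec b]add0r memv_add ?mem0v ?inN.
by apply: IH; rewrite (leq_trans wb).
Qed.

End FreeVectorSpaces.
Arguments bvec {F A}.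

(** * Label functions and their complex *)

Section Merge.
Local Open Scope nat_scope.

(* The effect on block labels 0, ..., p.+1 of merging the blocks i and i.+1,
   cyclically: merging at i = p.+1 sends the last label p.+1 to 0. *)
Definition merge_label (p i a : nat) : nat :=
  if a <= i then (if a <= p then a else 0) else a.-1.

Variant merge_label_spec (p i a : nat) : nat -> Prop :=
| MergeLow of a <= i & a <= p : merge_label_spec p i a a
| MergeLast of p < a <= i : merge_label_spec p i a 0
| MergeHigh b of i <= b & a = b.+1 : merge_label_spec p i a b.

Lemma merge_labelP p i a : merge_label_spec p i a (merge_label p i a).
Proof.
rewrite /merge_label; case: leqP => h; last by constructor 3; lia.
by case: leqP => h'; [constructor 1|constructor 2; rewrite h'].
Qed.

Lemma merge_label_le p i a : a <= p.+1 -> merge_label p i a <= p.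
Proof. by case: merge_labelP => *; lia. Qed.

(** The simplicial identity for faces. The range [j <= p.+2] includes the cyclic last face. *)
Lemma merge_labelC p i j a : i < j <= p.+2 -> a <= p.+2 ->
  merge_label p i (merge_label p.+1 j a) = merge_label p j.-1 (merge_label p.+1 i a).
Proof.
move=> ij ap; case: (merge_labelP p.+1 j a) => *; case: (merge_labelP p.+1 i a) => *;
  by case: merge_labelP => *; case: merge_labelP => *; lia.
Qed.

End Merge.

Section Cells.
Variables (n : nat) (S : {set 'I_n}).
Local Open Scope nat_scope.

(* A cyclic class of p.+1 blocks, given by the labels of its blocks, counted
   cyclically from the block that contains S. *)
Definition is_cell (p : nat) (g : {ffun 'I_n -> 'I_p.+1}) : bool :=
  [forall v in S, g v == ord0] && [forall j, exists v in ~: S, g v == j].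

Definition cell (p : nat) := {g : {ffun 'I_n -> 'I_p.+1} | is_cell g}.

Definition lab (p : nat) (c : cell p) (v : 'I_n) : nat := val c v.

Lemma lab_le p (c : cell p) v : lab c v <= p.
Proof. by rewrite -ltnS /lab. Qed.

Lemma lab_base p (c : cell p) v : v \in S -> lab c v = 0.
Proof.
by move=> vS; have /andP[/forall_inP/(_ v vS)/eqP cv _] := valP c; rewrite /lab cv.
Qed.

(** The witness lies outside [S]: for [j = 0] it is what lets the block of [S] contain a
    hyperedge. *)
Lemma lab_onto p (c : cell p) j : j <= p -> exists2 v, v \notin S & lab c v = j.
Proof.
rewrite -ltnS => jp; have /andP[_ /forallP/(_ (Ordinal jp))] := valP c.
move=> /existsP[v /andP[vS /eqP cv]]; exists v.
  by rewrite inE in vS.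
by rewrite /lab cv.
Qed.

Lemma lab_inj p (c d : cell p) : lab c =1 lab d -> c = d.
Proof. by move=> cd; apply/val_inj/ffunP => v; apply/val_inj/cd. Qed.

Lemma cell_of_lab p (g : 'I_n -> nat) :
  (forall v, g v <= p) -> (forall v, v \in S -> g v = 0) ->
  (forall j, j <= p -> exists2 v, v \notin S & g v = j) ->
  {c : cell p | lab c =1 g}.
Proof.
move=> gp gS gW; pose h := [ffun v => inord (g v) : 'I_p.+1].
have hE v : h v = g v :> nat by rewrite ffunE inordK // ltnS.
have hP : is_cell h.
  apply/andP; split; first by apply/forall_inP => v vS; rewrite -val_eqE /= hE gS.
  apply/forallP => j; have [v vS gv] := gW j (ltn_ord j).
  by apply/existsP; exists v; rewrite inE vS -val_eqE /= hE gv /=.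
by exists (exist _ h hP) => v; rewrite /lab /= hE.
Qed.

Fact face_subproof p i (c : cell p.+1) :
  {d : cell p | lab d =1 merge_label p i \o lab c}.
Proof.
apply: cell_of_lab => [v|v vS|j jp] /=; first exact/merge_label_le/lab_le.
  by rewrite lab_base.
(* A label that the merge at [i] sends to [j]. *)
have [v vS cv] : exists2 v, v \notin S & lab c v = (if j <= i then j else j.+1).
  by apply: lab_onto; case: ifP; lia.
by exists v; rewrite //= cv; case: merge_labelP; case: ifP => *; lia.
Qed.

Definition face p i (c : cell p.+1) : cell p := sval (face_subproof i c).

Lemma lab_face p i (c : cell p.+1) v : lab (face i c) v = merge_label p i (lab c v).
Proof. exact: (svalP (face_subproof i c)). Qed.

Lemma face_face p i j (c : cell p.+2) : i < j <= p.+2 ->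
  face i (face j c) = face j.-1 (face i c).
Proof.
by move=> ij; apply: lab_inj => v; rewrite !lab_face merge_labelC ?lab_le.
Qed.

End Cells.

Section CellComplex.
Variables (F : fieldType) (n : nat) (S : {set 'I_n}).

(** The Hochschild differential; the term [i = p.+1] is the cyclic face. *)
Definition bd_cell p (c : cell S p.+1) : freev F (cell S p) :=
  \sum_(i < p.+2) (-1) ^+ i *: bvec (face i c).

Definition bd p : 'Hom(freev F (cell S p.+1), freev F (cell S p)) :=
  linext (@bd_cell p).

Lemma bd_bd p : (bd p \o bd p.+1)%VF = 0.
Proof.
apply: lfun_bvecP => c; rewrite comp_lfunE linext_bvec zero_lfunE linear_sum /=.
under eq_bigr => j _.
  rewrite linearZ /= linext_bvec /bd_cell scaler_sumr.
  under eq_bigr => i _ do rewrite scalerA -exprD.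
  over.
rewrite pair_big /= (bigID (fun ij : 'I_p.+3 * 'I_p.+2 => (ij.2 < ij.1)%N)) /=.
(* For [i < j], [h] sends [(j, i)] to the term with the same double face, by [face_face], and the
   opposite sign; [h'] goes back. *)
pose h (ij : 'I_p.+3 * 'I_p.+2) : 'I_p.+3 * 'I_p.+2 := (inord ij.2, inord ij.1.-1).
pose h' (ij : 'I_p.+3 * 'I_p.+2) : 'I_p.+3 * 'I_p.+2 := (inord ij.2.+1, inord ij.1).
rewrite [X in _ + X](reindex_onto h h') /=; last first.
  move=> [j i] /=; rewrite -leqNgt => ji; rewrite /h /h' /=.
  have [jp ip] := (ltn_ord j, ltn_ord i).
  have ijp : (j < p.+2)%N by apply: leq_ltn_trans ip.
  by rewrite !(inordK ijp) (@inordK _ i.+1) //= !inord_val.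
rewrite [X in _ + X](eq_bigl (fun ij : 'I_p.+3 * 'I_p.+2 => (ij.2 < ij.1)%N)).
  rewrite -big_split big1 //= => -[j i] /= ij.
  have [jp ip] := (ltn_ord j, ltn_ord i).
  rewrite !inordK; try lia.
  rewrite face_face ?ij //.
  case: (nat_of_ord j) ij => // j' _; rewrite addSn exprS mulN1r scaleNr addnC.
  exact: addNr.
move=> [j i] /=; have [jp ip] := (ltn_ord j, ltn_ord i).
have jp' : (j.-1 < p.+2)%N by lia.
have ip' : (i < p.+3)%N by lia.
rewrite /h /h' /= !(inordK jp', inordK ip') inord_val -leqNgt.
case: (posnP j) => [j0|j_gt0]; last first.
  by rewrite prednK // inord_val eqxx andbT -ltnS prednK.
(* At [j = 0] the predecessor is truncated, so [h' (h ij)] has first component 1 and differs from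
   [ij]. *)
rewrite j0 ltn0; apply/negP => /andP[_ /eqP[/(congr1 val)/=]].
by rewrite inordK // j0.
Qed.

End CellComplex.

(** * Matching *)

Ltac merge_lia :=
  repeat match goal with |- context [merge_label ?p ?i ?a] =>
    case: (merge_labelP p i a) => [? ?|?|? ? ?]
  end; lia.

Section Matching.
Variables (n : nat) (S : {set 'I_n}).
Local Open Scope nat_scope.

Definition single p (c : cell S p) (l : nat) : bool :=
  [forall x, forall y, (lab c x == l) && (lab c y == l) ==> (x == y)].

(** When block [l] is a singleton, this says that its vertex exceeds the least vertex of block
    [l.+1]; the negation puts it below that whole block. *)
Definition descent p (c : cell S p) (l : nat) : bool :=
  [exists x : 'I_n, exists y : 'I_n,
    [&& lab c x == l, lab c y == l.+1 & y < x]].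

Definition stair p (c : cell S p) (j : nat) : bool :=
  [forall l : 'I_j, (0 < l) ==> single c l && descent c l].

(** The lower cells of the matching: splitting the least vertex off block [j] gives a cell paired at
    [j]. *)
Definition pivot_at p (c : cell S p) (j : nat) : bool :=
  [&& 0 < j <= p, stair c j & ~~ single c j].

Definition pivot p (c : cell S p) : bool := [exists j : 'I_p.+1, pivot_at c j].

(** The upper cells of the matching: the vertex of block [j] is below all of block [j.+1], so
    merging the two can be undone. The bound [j < p] makes block [j.+1] exist. *)
Definition paired_at p (c : cell S p) (j : nat) : bool :=
  [&& 0 < j < p, stair c j, single c j & ~~ descent c j].

Definition paired p (c : cell S p) : bool := [exists j : 'I_p, paired_at c j].

Definition critical p (c : cell S p) : bool :=
  [forall l : 'I_p.+1, (0 < l) ==> single c l && ((l < p) ==> descent c l)].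

Lemma singleP p (c : cell S p) l :
  reflect (forall x y, lab c x = l -> lab c y = l -> x = y) (single c l).
Proof.
apply: (iffP forallP) => [s x y cx cy|s x].
  by have /forallP/(_ y) := s x; rewrite cx cy !eqxx => /eqP.
by apply/forallP => y; apply/implyP => /andP[/eqP cx /eqP cy]; apply/eqP/s.
Qed.

Lemma singlePn p (c : cell S p) l :
  reflect (exists x y, [/\ lab c x = l, lab c y = l & x < y]) (~~ single c l).
Proof.
apply: (iffP idP) => [|[x [y [cx cy xy]]]]; last first.
  by apply/singleP => /(_ x y cx cy) e; rewrite e ltnn in xy.
rewrite negb_forall => /existsP[x]; rewrite negb_forall => /existsP[y].
rewrite negb_imply => /andP[/andP[/eqP cx /eqP cy]].
rewrite -val_eqE neq_ltn => /orP[xy|yx]; first by exists x, y.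
by exists y, x.
Qed.

Lemma descentP p (c : cell S p) l :
  reflect (exists x y, [/\ lab c x = l, lab c y = l.+1 & y < x]) (descent c l).
Proof.
apply: (iffP existsP) => [[x /existsP[y /and3P[/eqP cx /eqP cy yx]]]|].
  by exists x, y.
by move=> [x [y [cx cy yx]]]; exists x; apply/existsP; exists y; rewrite cx cy !eqxx.
Qed.

Lemma descentPn p (c : cell S p) l :
  reflect (forall x y, lab c x = l -> lab c y = l.+1 -> x < y) (~~ descent c l).
Proof.
apply: (iffP idP) => [nd x y cx cy|s]; last first.
  by apply/descentP => -[x [y [cx cy]]]; apply/negP; rewrite -leqNgt ltnW ?s.
rewrite ltn_neqAle leqNgt; apply/andP; split.
  by apply/eqP => /val_inj e; rewrite e cy in cx; lia.
by apply: contra nd => yx; apply/descentP; exists x, y.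
Qed.

Lemma stairP p (c : cell S p) j :
  reflect (forall l, 0 < l < j -> single c l /\ descent c l) (stair c j).
Proof.
apply: (iffP forallP) => [s l /andP[l0 lj]|s l].
  by have := s (Ordinal lj); rewrite l0 => /andP.
by apply/implyP => l0; apply/andP/s; rewrite l0 /=.
Qed.

(** The first block at which criticality fails decides: with several vertices it gives a pivot,
    otherwise the missing descent gives a paired cell. *)
Lemma cell_cases p (c : cell S p) : [|| pivot c, paired c | critical c].
Proof.
have [crit|] := boolP (critical c); first by rewrite !orbT.
rewrite /critical negb_forall => /existsP[i].
rewrite negb_imply => /andP[i0 bi]; rewrite orbF.
pose bad l := [&& 0 < l, l <= p & ~~ (single c l && ((l < p) ==> descent c l))].
have ex_bad : exists l, bad l by exists i; rewrite /bad i0 bi -ltnS ltn_ord.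
have [j /and3P[j0 jp bj] jmin] := ex_minnP ex_bad.
have st : stair c j.
  apply/stairP => l /andP[l0 lj]; apply/andP.
  have lp : l < p by apply: leq_trans jp.
  have : ~~ bad l by apply: contraL lj => /jmin; rewrite -leqNgt.
  by rewrite /bad l0 (ltnW lp) lp /= negbK.
have [sj|nsj] := boolP (single c j); last first.
  have jp' : j < p.+1 by [].
  by apply/orP; left; apply/existsP; exists (Ordinal jp'); apply/and3P; rewrite j0.
move: bj; rewrite sj negb_imply => /= /andP[jp' nd].
by apply/orP; right; apply/existsP; exists (Ordinal jp'); apply/and4P; rewrite j0.
Qed.

(** The diagonal pairs count the vertices outside block 0, so that the weight also drops when a
    block is absorbed into block 0. *)
Definition inversions p (c : cell S p) : {set 'I_n * 'I_n} :=
  [set xy | (lab c xy.1 != 0) &&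
     ((xy.1 == xy.2) || (lab c xy.1 < lab c xy.2) && (xy.2 < xy.1))].

Definition weight p (c : cell S p) : nat := #|inversions c|.

Lemma inversions_face p (b : cell S p.+1) i :
  inversions (face i b) \subset inversions b.
Proof.
apply/subsetP => -[x y]; rewrite !inE /= !lab_face.
have := lab_le b x; have := lab_le b y.
merge_lia.
Qed.

Lemma weight_face_lt p (b : cell S p.+1) i xy :
  xy \in inversions b -> xy \notin inversions (face i b) ->
  weight (face i b) < weight b.
Proof.
move=> xyb xyf; apply/proper_card/properP; split; first exact: inversions_face.
by exists xy.
Qed.

(** Only inversions between blocks [j] and [j.+1] could be lost, and without a descent there are
    none. *)
Lemma weight_face_paired p (b : cell S p.+1) j :
  paired_at b j -> weight (face j b) = weight b.
Proof.
case/and4P => jp _ _ /descentPn nd; congr #|pred_of_set _|.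
apply/eqP; rewrite eqEsubset inversions_face; apply/subsetP => -[x y].
rewrite !inE /= !lab_face; have := lab_le b x; have := lab_le b y; have := nd x y.
merge_lia.
Qed.

Lemma pivot_face_paired p (b : cell S p.+1) j :
  paired_at b j -> pivot_at (face j b) j.
Proof.
case/and4P => jp /stairP st /singleP sj /descentPn nd; apply/and3P; split => //.
  apply/stairP => l lj; have [/singleP sl /descentP[x [y [bx by_ yx]]]] := st l lj.
  split.
    by apply/singleP => u v; rewrite !lab_face => fu fv;
      apply: sl; move: fu fv; merge_lia.
  apply/descentP; exists x, y; rewrite !lab_face bx by_; split => //.
    merge_lia.
  merge_lia.
have [x _ bx] : exists2 x, x \notin S & lab b x = j by apply: lab_onto; lia.
have [y _ by_] : exists2 y, y \notin S & lab b y = j.+1 by apply: lab_onto; lia.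
apply/singlePn; exists x, y; rewrite !lab_face bx by_ nd //; split => //.
  merge_lia.
merge_lia.
Qed.

(** The triangularity behind the rank bound: a pivot face other than face [j] has lost an inversion,
    which depends on the position of [i]. *)
Lemma weight_face_pivot p (b : cell S p.+1) i j : paired_at b j ->
  i <= p.+1 -> i != j -> pivot (face i b) -> weight (face i b) < weight b.
Proof.
case/and4P => jp /stairP st /singleP sj /descentPn nd ip ij.
case/existsP => l /and3P[lp /stairP stl /singlePn[u [v [fu fv uv]]]].
(* The outer faces absorb block 1 or block [p.+1] into block 0, at the cost of a diagonal pair. *)
have [i0|i_gt0] := posnP i.
  have [x _ bx] : exists2 x, x \notin S & lab b x = 1 by apply: lab_onto; lia.
  apply: (@weight_face_lt _ _ _ (x, x)); rewrite !inE /= ?lab_face bx ?eqxx //.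
  merge_lia.
have [ipE|ip'] := eqVneq i p.+1.
  have [x _ bx] : exists2 x, x \notin S & lab b x = p.+1 by apply: lab_onto; lia.
  apply: (@weight_face_lt _ _ _ (x, x)); rewrite !inE /= ?lab_face bx ?eqxx //.
  merge_lia.
(* For [i < j] the descent from block [i] to block [i.+1] is an inversion that the merge
   destroys. *)
have [i_lt|i_gt] : i < j \/ j < i by lia.
  have [_ /descentP[x [y [bx by_ yx]]]] : single b i /\ descent b i by apply: st; lia.
  apply: (@weight_face_lt _ _ _ (x, y)); rewrite !inE /= ?lab_face bx by_.
    by rewrite yx ltnSn /= orbT andbT; lia.
  rewrite -[x == y]val_eqE /=; merge_lia.
(* Now [j < i]. A pivot position [l <= j] is impossible, since blocks 1 to [j] are unchanged
   singletons. *)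
have [lj|lj] := leqP l j.
  have : u = v.
    move: fu fv; rewrite !lab_face => fu fv.
    have bu : lab b u = l by move: fu; merge_lia.
    have bv : lab b v = l by move: fv; merge_lia.
    have [l_lt|lE] : l < j \/ l = j :> nat by lia.
      have [/singleP sl _] : single b l /\ descent b l by apply: st; lia.
      exact: sl bu bv.
    by apply: sj; rewrite ?bu ?bv.
  by move=> e; rewrite e ltnn in uv.
(* As [j < l], the face has a descent at [j], which [b] lacks. So [i = j.+1] and [y] comes from
   block [j.+2]; with [y < x < z], the pair [(z, y)] is a lost inversion. *)
have [_ /descentP[x [y [fx fy yx]]]] : single (face i b) j /\ descent (face i b) j.
  by apply: stl; lia.
have [z _ bz] : exists2 z, z \notin S & lab b z = j.+1 by apply: lab_onto; lia.
move: fx fy; rewrite !lab_face => fx fy.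
have bx : lab b x = j by move: fx; merge_lia.
have xz := nd x z bx bz.
have := nd x y bx => ndy.
have [iE bY] : i = j.+1 /\ lab b y = j.+2 by move: fy; merge_lia.
apply: (@weight_face_lt _ _ _ (z, y)); rewrite !inE /= ?lab_face bz bY ?iE.
  by apply/andP; split => //; apply/orP; right; rewrite ltnSn (ltn_trans yx).
rewrite -[z == y]val_eqE /=; merge_lia.
Qed.

Lemma split_pivot p (a : cell S p) j : pivot_at a j ->
  exists2 b : cell S p.+1, paired_at b j & face j b = a.
Proof.
case/and3P => /andP[j0 jp] /stairP st /singlePn[u [v [au av uv]]].
have aj : lab a u == j by apply/eqP.
(* [m] is the least vertex of block [j]; [g] keeps it there and moves the rest of that block and all
   later blocks up by one. *)
have [m /eqP am m_min] := @arg_minnP _ u (fun x => lab a x == j) val aj.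
pose g x := lab a x + ((j < lab a x) || (lab a x == j) && (x != m)).
have a_notS x : 0 < lab a x -> x \notin S.
  by apply: contraTN => /(lab_base a) ->.
have vm : v != m by rewrite -val_eqE /=; have /= := m_min u aj; lia.
have gP x : [\/ lab a x < j /\ g x = lab a x, x = m /\ g x = j,
    [/\ lab a x = j, x != m & g x = j.+1] | j < lab a x /\ g x = (lab a x).+1].
  rewrite /g; case: (ltngtP (lab a x) j) => [h|h|h] /=; rewrite ?addn0 ?addn1.
  - by constructor 1.
  - by constructor 4.
  - have [->|xm] := eqVneq x m; first by constructor 2; rewrite am addn0.
    by constructor 3; rewrite h addn1.
have [b bE] : {b : cell S p.+1 | lab b =1 g}.
  apply: cell_of_lab => [x|x xS|l lp].
  - by have := lab_le a x; rewrite /g; case: (_ || _); lia.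
  - by rewrite /g lab_base //; case: (j) j0.
  - have [lj|lj|lE] := ltngtP l j.
    + have [x xS ax] : exists2 x, x \notin S & lab a x = l by apply: lab_onto; lia.
      by exists x; rewrite // /g ax; lia.
    + have [lE|lj'] := eqVneq l j.+1.
        by exists v; [apply: a_notS; rewrite av|rewrite lE /g av ltnn eqxx vm addn1].
      have [x xS ax] : exists2 x, x \notin S & lab a x = l.-1 by apply: lab_onto; lia.
      by exists x; rewrite // /g ax (_ : j < l.-1); lia.
    + by exists m; [apply: a_notS; rewrite am|rewrite lE /g am ltnn !eqxx addn0].
exists b; last first.
  apply: lab_inj => x; rewrite lab_face bE.
  by case: (gP x) => [[h ->]|[-> ->]|[h _ ->]|[h ->]]; have := lab_le a x; merge_lia.
have blt l x : l < j -> lab b x = l <-> lab a x = l.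
  by rewrite bE; case: (gP x) => [[h ->]|[-> ->]|[h _ ->]|[h ->]]; lia.
have bjE x : lab b x = j -> x = m.
  by rewrite bE; case: (gP x) => [[h ->]|[-> ->]|[h _ ->]|[h ->]] //; lia.
apply/and4P; split; first by rewrite j0.
- apply/stairP => l /andP[l0 lj].
  have [/singleP sl /descentP[x [y [ax ay yx]]]] : single a l /\ descent a l.
    by apply: st; rewrite l0.
  split; first by apply/singleP => x' y' /blt-/(_ lj) ? /blt-/(_ lj) ?; apply: sl.
  apply/descentP; exists x; have [lj'|lE] : l.+1 < j \/ l.+1 = j by lia.
    by exists y; split; rewrite ?blt //; apply/blt.
  exists m; split; [exact/blt|by rewrite bE /g am ltnn !eqxx addn0|].
  by rewrite (leq_ltn_trans _ yx) // m_min // ay lE.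
- by apply/singleP => x y /bjE-> /bjE->.
- apply/descentPn => x y /bjE->; rewrite bE.
  case: (gP y) => [[h ->]|[-> ->]|[h ym _]|[h ->]] e; try lia.
  by rewrite ltn_neqAle eq_sym val_eqE ym m_min ?h.
Qed.

(** The position is recovered as the first block of the face, after block 0, that is not a
    singleton, and the split as the removal of its least vertex. *)
Lemma paired_face_inj p (b b' : cell S p.+1) j j' :
  paired_at b j -> paired_at b' j' -> face j b = face j' b' -> b = b'.
Proof.
move=> pb pb' fE.
have pivot_le (a : cell S p) i i' : pivot_at a i -> pivot_at a i' -> i <= i'.
  case/and3P => _ /stairP st _ /and3P[i'0 _ ns]; rewrite leqNgt.
  by apply: contra ns => i'i; have [] : single a i' /\ descent a i' by apply: st; lia.
have jj' : j = j'.
  have := pivot_face_paired pb'; have := pivot_face_paired pb; rewrite -fE => pj pj'.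
  by apply/eqP; rewrite eqn_leq !(pivot_le (face j b)).
move: pb' fE; rewrite -{j'}jj' => pb' fE.
(* The vertex [y] of block [j] of [d] is below [x]. In [c] it shares the singleton block of [x], or
   lies in the next block and is above [x]; both are absurd. *)
have half (c d : cell S p.+1) x : paired_at c j -> paired_at d j ->
    face j c = face j d -> lab c x = j -> lab d x = j.+1 -> False.
  case/and4P => jp _ /singleP sc /descentPn nc /and4P[_ _ _ /descentPn nd] cd cx dx.
  have [y _ dy] : exists2 y, y \notin S & lab d y = j by apply: lab_onto; lia.
  have yx := nd y x dy dx.
  have := congr1 (fun e => lab e y) cd; rewrite /= !lab_face dy => e.
  have [cy|cy] : lab c y = j \/ lab c y = j.+1 by move: e; merge_lia.
    by rewrite (sc x y cx cy) ltnn in yx.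
  by have := nc x y cx cy; lia.
apply: lab_inj => x.
have := congr1 (fun e => lab e x) fE; rewrite /= !lab_face => e.
have := half b b' x pb pb' fE; have := half b' b x pb' pb (esym fE).
case/and4P: pb => jp _ _ _; have := lab_le b x; have := lab_le b' x.
by move: e; merge_lia.
Qed.

Lemma critical_single p (c : cell S p) x y :
  critical c -> 0 < lab c x -> lab c x = lab c y -> x = y.
Proof.
move=> /forallP/(_ (val c x))/implyP crit c0 cxy.
by have /andP[/singleP s _] := crit c0; apply: s.
Qed.

Lemma critical_decr p (c : cell S p) x y :
  critical c -> 0 < lab c x -> lab c x < lab c y -> y < x.
Proof.
move=> crit; move: x; suff dec d x : 0 < lab c x -> lab c x + d.+1 = lab c y -> y < x.
  by move=> x c0 cxy; apply: (dec (lab c y - lab c x).-1) => //; lia.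
elim: d x => [|d IH] x c0 e; have yp := lab_le c y.
all: have := crit => /forallP/(_ (val c x))/implyP/(_ c0)/andP[_].
all: have xp : val c x < p by rewrite -/(lab c x); lia.
all: rewrite xp /= => /descentP[x' [z [cx' cz zx']]].
all: have xE : x = x' by apply: (critical_single crit c0); rewrite cx'.
all: rewrite -xE in zx'.
  rewrite (critical_single crit (x := y) (y := z)) //;
  by rewrite ?cz -?[nat_of_ord _]/(lab c x); lia.
by apply: ltn_trans zx'; apply: IH; rewrite cz -?[nat_of_ord _]/(lab c x); lia.
Qed.

Definition support p (c : cell S p) : {set 'I_n} := [set v | 0 < lab c v].

Lemma support_sub p (c : cell S p) : support c \subset ~: S.
Proof.
by apply/subsetP => v; rewrite !inE; apply: contraTN => /(lab_base c) ->.
Qed.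

Lemma card_support_critical p (c : cell S p) : critical c -> #|support c| = p.
Proof.
move=> crit; rewrite -(card_in_imset (f := val c)) => [|x y]; last first.
  by rewrite !inE => cx cy cxy; apply: (critical_single crit cx); rewrite /lab cxy.
have -> : val c @: support c = [set~ ord0].
  apply/setP => j; rewrite !inE; apply/imsetP/idP => [[x]|j0].
    by rewrite inE /lab -val_eqE => cx ->; rewrite -lt0n.
  have [x _ cx] := lab_onto c (ltn_ord j : j <= p).
  by exists x; [rewrite inE cx lt0n|apply/val_inj/esym].
by rewrite cardsC1 card_ord.
Qed.

(** A critical cell lists its support in decreasing order, one vertex per block. *)
Lemma support_inj p : {in @critical p &, injective (@support p)}.
Proof.
move=> c d crit_c crit_d supE.
have same0 v : (0 < lab c v) = (0 < lab d v).
  by have /setP/(_ v) := supE; rewrite !inE.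
(* If the blocks below [l] agree, distinct vertices [v] and [w] in block [l] of [e] and [f] would
   satisfy both [w < v] and [v < w]. *)
have half (e f : cell S p) l v : critical e -> critical f ->
    (forall x, (0 < lab e x) = (0 < lab f x)) ->
    (forall l', l' < l -> forall x, (lab e x == l') = (lab f x == l')) ->
    lab e v = l -> lab f v = l.
  move=> crit_e crit_f ef IH ev.
  have [l0|l_gt0] := posnP l; first by have := ef v; lia.
  have lp : l <= p by rewrite -ev lab_le.
  have [w _ fw] := lab_onto f lp.
  have ew : l <= lab e w.
    by rewrite leqNgt; apply/negP => h; have := IH _ h w; rewrite fw; lia.
  have fv : l <= lab f v.
    by rewrite leqNgt; apply/negP => h; have := IH _ h v; rewrite ev; lia.
  move: ew; rewrite leq_eqVlt => /orP[/eqP ew|ew].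
    by rewrite (critical_single crit_e (x := v) (y := w)) ?ev.
  have wv : w < v by apply: (critical_decr crit_e); rewrite ev.
  move: fv; rewrite leq_eqVlt => /orP[/eqP //|fv].
  have : v < w by apply: (critical_decr crit_f); rewrite fw.
  by lia.
suff same l : forall v, (lab c v == l) = (lab d v == l).
  by apply: lab_inj => v; apply/esym/eqP; rewrite -same.
elim/ltn_ind: l => l IH v; apply/eqP/eqP; first exact: half.
by apply: half => // l' /IH.
Qed.

Lemma card_critical p : #|@critical p| <= 'C(#|~: S|, p).
Proof.
rewrite -cards_draws -(card_in_imset (@support_inj p)).
apply/subset_leq_card/subsetP => _ /imsetP[c crit ->].
by rewrite inE support_sub card_support_critical /=.
Qed.

Lemma card_paired p : #|@paired p.+1| <= #|@pivot p|.
Proof.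
pose f (b : cell S p.+1) : cell S p :=
  if [pick j : 'I_p.+1 | paired_at b j] is Some j then face j b else face 0 b.
have fP b : paired b -> exists2 j, paired_at b j & f b = face j b.
  move=> /existsP[j bj]; rewrite /f; case: pickP => [i bi|/(_ j)]; first by exists i.
  by rewrite bj.
rewrite -(card_in_imset (f := f)) => [|b b' /fP[j bj ->] /fP[j' bj' ->]]; last first.
  exact: paired_face_inj.
apply/subset_leq_card/subsetP => _ /imsetP[b /fP[j bj ->] ->].
have piv := pivot_face_paired bj.
have jp : j < p.+1 by case/and3P: piv => /andP[].
by apply/existsP; exists (Ordinal jp).
Qed.

Lemma card_cell_cases p :
  #|{: cell S p}| <= #|@pivot p| + #|@paired p| + #|@critical p|.
Proof.
rewrite -(cardsE (@pivot p)) -(cardsE (@paired p)) -(cardsE (@critical p)).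
rewrite -cardsT.
apply: leq_trans (leq_add (leq_card_setU _ _).1 (leqnn _)).
apply: leq_trans (leq_card_setU _ _).1.
by apply/subset_leq_card/subsetP => c _; rewrite !inE -orbA cell_cases.
Qed.

Lemma card_cell0 : #|{: cell S 0}| <= #|@pivot 0| + 1.
Proof.
have := card_cell_cases 0; have := card_critical 0; rewrite bin0.
by have -> : #|@paired 0| = 0; [apply: eq_card0 => c; apply/existsP => -[[]]|lia].
Qed.

Lemma card_cellS p :
  #|{: cell S p.+1}| <= #|@pivot p| + #|@pivot p.+1| + 'C(#|~: S|, p.+1).
Proof.
by have := card_cell_cases p.+1; have := card_critical p.+1; have := card_paired p; lia.
Qed.

End Matching.

(** * A lower bound for the rank of the boundary map *)

Section Rank.
Variables (F : fieldType) (n : nat) (S : {set 'I_n}).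
Local Open Scope nat_scope.

Lemma rank_bd_ge p : #|@pivot n S p| <= \dim (limg (bd F S p)).
Proof.
apply: (card_pivots_le_rank (w := @weight n S p)) => a /existsP[j piv].
have [b pb fb] := split_pivot piv.
have jp : j < p.+2 by apply: ltnW; rewrite ltnS.
(* Face [j] of the split cell [b] is [a]; every other face is a non-pivot or has smaller weight. *)
exists (bvec b), ((-1) ^+ j)%R; split; first by rewrite signr_eq0.
rewrite linext_bvec /bd_cell (bigD1 (Ordinal jp)) //= fb [X in (X - _)%R]addrC addrK.
apply: memv_suml => i ij; apply/memvZ/memv_span/imageP.
exists (face i b) => //; rewrite inE.
have [piv_i|//] := boolP (pivot (face i b)).
rewrite -fb (weight_face_paired pb) (weight_face_pivot pb) //.
by rewrite -ltnS.
Qed.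

End Rank.

(** * Cocycles and cycles *)

Section Cocycle.
Variables (n : nat) (S T : {set 'I_n}).
Local Open Scope nat_scope.

(** The position of [v] in the increasing list of [T], from 0; outside [T] the value is [#|T|]. *)
Definition rank_in (v : 'I_n) : nat := index v (enum T).

Lemma rank_in_lt v : (rank_in v < #|T|) = (v \in T).
Proof. by rewrite cardE index_mem mem_enum. Qed.

Lemma rank_in_onto i : i < #|T| -> exists2 v, v \in T & rank_in v = i.
Proof.
rewrite cardE => iT; have v0 : 'I_n by case: (enum T) iT.
exists (nth v0 (enum T) i); first by rewrite -mem_enum mem_nth.
by rewrite /rank_in index_uniq ?enum_uniq.
Qed.

Lemma rank_in_inj : {in T &, injective rank_in}.
Proof. by move=> u v uT vT; apply: (index_inj u); rewrite mem_enum. Qed.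

(* The cup product of the degree 1 cocycles dual to the vertices of T, taken
   in increasing order. *)
Definition cup p (c : cell S p) : bool :=
  [forall v in T, lab c v == (rank_in v).+1].

(** [a m] says that the vertices of [T] lie, in order, in the blocks 1 to [p.+1] except [m.+1]. The
    merge at [i] closes this gap exactly when the gap is [i.+1] or [i], whence the two terms. *)
Lemma cup_face p (c : cell S p.+1) i : #|T| = p -> i <= p.+1 ->
  let a m := [forall v in T, lab c v == (rank_in v).+1 + (m <= rank_in v)] in
  cup (face i c) = ((i <= p) && a i) + ((0 < i) && a i.-1) :> nat.
Proof.
move=> Tp ip a.
have rp v : v \in T -> rank_in v < p by rewrite -Tp rank_in_lt.
have aP m : reflect (forall v, v \in T ->
    lab c v = (rank_in v).+1 + (m <= rank_in v)) (a m).
  by apply: (iffP forall_inP) => h v /h /eqP.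
(* The vertex of rank [i.-1] tells the two gaps apart, so at most one term is 1. *)
have excl : 0 < i -> i <= p -> a i -> a i.-1 -> False.
  move=> i0 ip' /aP h /aP h'; have [|v vT rv] := @rank_in_onto i.-1.
    by rewrite Tp; lia.
  by have := h v vT; rewrite (h' v vT) rv; lia.
have [cupf|ncupf] := boolP (cup (face i c)).
  have cf v : v \in T -> merge_label p i (lab c v) = (rank_in v).+1.
    by move=> vT; have /forall_inP/(_ v vT)/eqP := cupf; rewrite lab_face.
  have [i0|i_gt0] := posnP i.
    suff -> : a i by rewrite i0.
    apply/aP => v vT; have := rp v vT; have := lab_le c v; have := cf v vT.
    by merge_lia.
  have [ipE|ip'] : i = p.+1 \/ i <= p by lia.
    suff -> : a i.-1 by rewrite ?i_gt0 ipE ltnn.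
    apply/aP => v vT; have := rp v vT; have := lab_le c v; have := cf v vT.
    by merge_lia.
  rewrite ip' ?i_gt0 /=; have [|v vT rv] := @rank_in_onto i.-1; first by rewrite Tp; lia.
  have [cv|cv] : lab c v = i \/ lab c v = i.+1.
    - by have := cf v vT; rewrite rv; merge_lia.
    - have ai : a i.
        apply/aP => u uT; have := rp u uT; have := cf u uT.
        have [uv|uv] := eqVneq (rank_in u) (rank_in v); last by merge_lia.
        by rewrite (rank_in_inj uT vT uv) cv rv; lia.
      by rewrite ai (negPf (introN idP (excl i_gt0 ip' ai))).
    - have ai : a i.-1.
        apply/aP => u uT; have := rp u uT; have := cf u uT.
        have [uv|uv] := eqVneq (rank_in u) (rank_in v); last by merge_lia.
        by rewrite (rank_in_inj uT vT uv) cv rv; lia.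
      by rewrite ai (negPf (introN idP (fun h => excl i_gt0 ip' h ai))).
case: (boolP (_ && a i)) => [/andP[ip' /aP ai]|_].
  case/negP: ncupf; apply/forall_inP => v vT; rewrite lab_face ai //.
  by have := rp v vT; merge_lia.
case: (boolP (_ && a _)) => [/andP[ip' /aP ai]|//].
case/negP: ncupf; apply/forall_inP => v vT; rewrite lab_face ai //.
by have := rp v vT; merge_lia.
Qed.

(** By [cup_face], each [a m] occurs at [i = m] and at [i = m.+1], with opposite signs. *)
Lemma cup_cocycle (R : pzRingType) p (c : cell S p.+1) : #|T| = p ->
  (\sum_(i < p.+2) (-1) ^+ i * (cup (face i c))%:R = 0 :> R)%R.
Proof.
move=> Tp.
pose a m := [forall v in T, lab c v == (rank_in v).+1 + (m <= rank_in v)].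
rewrite (eq_bigr (fun i : 'I_p.+2 => ((-1) ^+ i * ((i <= p)%N && a i)%:R +
    (-1) ^+ i * ((0 < i)%N && a i.-1)%:R)%R)) => [|i _]; last first.
  by rewrite -mulrDr -natrD -cup_face // -ltnS.
rewrite big_split /= big_ord_recr [X in (_ + X)%R]big_ord_recl /=.
rewrite ltnn !mulr0 addr0 add0r -big_split big1 //= => i _.
by rewrite -ltnS ltn_ord /= /bump add1n exprS mulN1r mulNr subrr.
Qed.

End Cocycle.

(** * Cycles obtained by antisymmetrizing over block permutations *)

Section Cycle.
Variables (n : nat) (S : {set 'I_n}).

Definition relabel_ord p (s : {perm 'I_p}) : {perm 'I_p.+1} :=
  lift_perm ord0 ord0 s.

Fact relabel_subproof p (s : {perm 'I_p}) (c : cell S p) :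
  {d : cell S p | lab d =1 fun v => relabel_ord s (val c v)}.
Proof.
apply: cell_of_lab => [v|v vS|j jp]; first by rewrite -ltnS.
  have -> : val c v = ord0 by apply/val_inj/(lab_base c vS).
  by rewrite /relabel_ord lift_perm_id.
pose k := (relabel_ord s)^-1%g (inord j).
have [v vS cv] := lab_onto c (ltn_ord k : (k <= p)%N).
exists v => //; have -> : val c v = k by apply/val_inj.
by rewrite permKV inordK.
Qed.

Definition relabel p (s : {perm 'I_p}) (c : cell S p) : cell S p :=
  sval (relabel_subproof s c).

Lemma lab_relabel0 p (s : {perm 'I_p}) (c : cell S p) v :
  lab c v = 0%N -> lab (relabel s c) v = 0%N.
Proof.
move=> cv; rewrite (svalP (relabel_subproof s c)).
have -> : val c v = ord0 by apply/val_inj.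
by rewrite /relabel_ord lift_perm_id.
Qed.

Lemma lab_relabelS p (s : {perm 'I_p}) (c : cell S p) v (i : 'I_p) :
  lab c v = i.+1 -> lab (relabel s c) v = (s i).+1.
Proof.
move=> cv; rewrite (svalP (relabel_subproof s c)).
have -> : val c v = lift ord0 i by apply/val_inj.
by rewrite /relabel_ord lift_perm_lift.
Qed.

(** The transposition exchanges the labels [i.+1] and [i.+2], which face [i.+1] identifies. *)
Lemma face_relabel_swap p (s : {perm 'I_p.+1}) (c : cell S p.+1) (i : 'I_p) :
  face i.+1 (relabel (s * tperm (widen_ord (leqnSn p) i) (lift ord0 i)) c) =
  face i.+1 (relabel s c).
Proof.
apply: lab_inj => v; rewrite !lab_face.
have [cv|cv] := posnP (lab c v); first by rewrite !lab_relabel0.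
have cvp : ((lab c v).-1 < p.+1)%N by have := lab_le c v; lia.
have cvE : lab c v = (Ordinal cvp).+1 by rewrite /= prednK.
rewrite !(lab_relabelS _ cvE) permM.
have ip := ltn_ord i.
by case: tpermP => [->|->|_ _] //; rewrite lift0 /=; merge_lia.
Qed.

(** On labels, the cycle that sends 1 to [p.+1] and lowers every other positive label by one. *)
Definition rot_perm p : {perm 'I_p.+1} := lift_perm ord0 ord_max 1%g.

Lemma face_relabel_rot p (s : {perm 'I_p.+1}) (c : cell S p.+1) :
  face p.+1 (relabel (s * rot_perm p) c) = face 0 (relabel s c).
Proof.
apply: lab_inj => v; rewrite !lab_face.
have [cv|cv] := posnP (lab c v); first by rewrite !lab_relabel0.
have cvp : ((lab c v).-1 < p.+1)%N by have := lab_le c v; lia.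
have cvE : lab c v = (Ordinal cvp).+1 by rewrite /= prednK.
rewrite !(lab_relabelS _ cvE) permM /rot_perm.
case: (unliftP ord0 (s (Ordinal cvp))) => [j|] ->.
  rewrite lift_perm_lift perm1 lift_max lift0.
  by move: j (ltn_ord j) => /= j jp; merge_lia.
by rewrite lift_perm_id /=; merge_lia.
Qed.

Lemma odd_rot_perm p : rot_perm p = odd p :> bool.
Proof. by rewrite /rot_perm odd_lift_perm odd_perm1 addbF. Qed.

Variable F : fieldType.
Hypothesis charF0 : [pchar F] =i pred0.

Definition antisym p (c : cell S p) : freev F (cell S p) :=
  \sum_(s : {perm 'I_p}) (-1) ^+ s *: bvec (relabel s c).

(** Each inner face cancels within itself, by exchanging the two merged blocks; the two outer faces
    cancel each other, by rotation. *)
Lemma antisym_cycle p (c : cell S p.+1) : bd F S p (antisym c) = 0.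
Proof.
pose X i : freev F (cell S p) :=
  \sum_(s : {perm 'I_p.+1}) (-1) ^+ s *: bvec (face i (relabel s c)).
have -> : bd F S p (antisym c) = \sum_(i < p.+2) (-1) ^+ i *: X i.
  rewrite linear_sum /=; under eq_bigr => s _ do
    rewrite linearZ /= linext_bvec /bd_cell scaler_sumr.
  rewrite exchange_big /=; apply: eq_bigr => i _; rewrite scaler_sumr.
  by apply: eq_bigr => s _; rewrite !scalerA mulrC.
have Xmid (i : 'I_p) : X i.+1 = 0.
  (* The sum is its own negative, hence zero because 2 is nonzero in characteristic zero. *)
  have : X i.+1 = - X i.+1.
    rewrite {1}/X; pose t := tperm (widen_ord (leqnSn p) i) (lift ord0 i).
    rewrite (reindex_inj (mulIg t)) /= -sumrN; apply: eq_bigr => s _.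
    rewrite face_relabel_swap odd_permM odd_tperm signr_addb -val_eqE /=.
    by rewrite /bump add1n ltn_eqF // expr1 mulrN1 scaleNr.
  move/eqP; rewrite -addr_eq0 -mulr2n -scaler_nat scaler_eq0.
  by rewrite (iffLR (pcharf0P F) charF0) => /eqP.
rewrite big_ord_recl big_ord_recr big1 /= => [|i _]; last first.
  by rewrite /bump add1n Xmid scaler0.
(* Rotation turns face [p.+1] into face 0; its sign [(-1)^p] times the sign [(-1)^(p+1)] of the face
   is -1. *)
rewrite add0r expr0 scale1r /bump add1n {2}/X (reindex_inj (mulIg (rot_perm p))).
rewrite scaler_sumr -big_split big1 //= => s _.
rewrite face_relabel_rot odd_permM odd_rot_perm signr_addb signr_odd scalerA.
by rewrite exprS mulrCA mulN1r mulNr -expr2 sqrr_sign mulrN1 scaleNr subrr.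
Qed.

End Cycle.

(** * Dimension of the homology of the cell complex *)

Section CellHomology.
Variables (F : fieldType) (n : nat) (S : {set 'I_n}).
Hypothesis charF0 : [pchar F] =i pred0.

Definition cycles p : {vspace freev F (cell S p)} :=
  match p with 0 => fullv | p'.+1 => lker (bd F S p') end.

Lemma boundaries_sub_cycles p : (limg (bd F S p) <= cycles p)%VS.
Proof.
case: p => [|p] /=; first exact: subvf.
apply/subvP => _ /memv_imgP[x _ ->].
by rewrite memv_ker -comp_lfunE bd_bd zero_lfunE.
Qed.

Lemma antisym_in_cycles p (c : cell S p) : antisym F c \in cycles p.
Proof.
case: p c => [|p] c /=; first exact: memvf.
by rewrite memv_ker antisym_cycle.
Qed.

Lemma dim_cycles p : (\dim (cycles p) +
  (if p is p'.+1 then \dim (limg (bd F S p')) else 0) = #|{: cell S p}|)%N.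
Proof.
case: p => [|p] /=; first by rewrite addn0 dim_freev.
by rewrite -[in LHS](capfv (lker _)) limg_ker_dim dim_freev.
Qed.

(** By rank and nullity: the cells number at most the pivots of this degree and of the degree below
    plus the binomial, and each pivot count is bounded by a rank. *)
Lemma dim_cycles_le p :
  (\dim (cycles p) <= \dim (limg (bd F S p)) + 'C(#|~: S|, p))%N.
Proof.
have := dim_cycles p; have := rank_bd_ge F S p.
case: p => [|p]; first by have := card_cell0 S; rewrite bin0; lia.
by have := card_cellS S p; have := rank_bd_ge F S p; lia.
Qed.

Definition base_set p : {set {set 'I_n}} :=
  [set T : {set 'I_n} | T \subset ~: S & #|T| == p].

Definition cups p : 'Hom(freev F (cell S p), freev F {T | T \in base_set p}) :=
  linext (fun c : cell S p => ([ffun T : {T | T \in base_set p} =>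
    (cup (val T) c)%:R : F^o] : freev F {T | T \in base_set p})).

Lemma cups_bd p : (cups p \o bd F S p)%VF = 0.
Proof.
apply: lfun_bvecP => c; rewrite comp_lfunE linext_bvec zero_lfunE linear_sum /=.
apply/ffunP => T; rewrite sum_ffunE ffunE.
have Tp : #|val T| = p by have := valP T; rewrite inE => /andP[_ /eqP].
rewrite -[RHS](cup_cocycle F c Tp); apply: eq_bigr => i _.
by rewrite linearZ /= linext_bvec !ffunE.
Qed.

Lemma cups_antisym p (T : {T | T \in base_set p}) : (p < #|~: S|)%N ->
  exists c : cell S p, cups p (antisym F c) = bvec T.
Proof.
move=> pS; have [T_S /eqP Tp] : val T \subset ~: S /\ #|val T| == p.
  by apply/andP; have := valP T; rewrite inE.
(* The vertices of [T] form the singleton blocks 1 to [p]; all others go to block 0. *)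
have [c cE] : {c : cell S p |
    lab c =1 fun v => if v \in val T then (rank_in (val T) v).+1 else 0%N}.
  apply: cell_of_lab => [v|v vS|[|j] jp].
  - by case: ifP => //; rewrite -rank_in_lt Tp.
  - by case: ifP => // /(subsetP T_S); rewrite inE vS.
  (* Block 0 needs a vertex of [~: S] outside [T], which exists because [p < #|~: S|]. *)
  - have : (0 < #|~: S :\: val T|)%N by rewrite cardsDS // Tp subn_gt0.
    by case/card_gt0P => v; rewrite !inE => /andP[vT vS]; exists v; rewrite // (negPf vT).
  - have [|v vT rv] := @rank_in_onto _ (val T) j; first by rewrite Tp.
    by exists v; [have := subsetP T_S v vT; rewrite inE|rewrite vT rv].
exists c; apply/ffunP => T'; rewrite linear_sum /= sum_ffunE ffunE.
have T'p : #|val T'| = p by have := valP T'; rewrite inE => /andP[_ /eqP].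
under eq_bigr => s _ do rewrite linearZ /= linext_bvec !ffunE.
have relabelE (s : {perm 'I_p}) v (vT : v \in val T)
    (vp : (rank_in (val T) v < p)%N) : lab (relabel s c) v = (s (Ordinal vp)).+1.
  by apply: lab_relabelS; rewrite cE vT.
have rT v : v \in val T -> (rank_in (val T) v < p)%N by rewrite -rank_in_lt Tp.
(* Only the identity permutation contributes, and only at [T' = T]. *)
rewrite (bigD1 1%g) //= [X in _ + X]big1 => [|s s1].
  rewrite addr0 odd_perm1 expr0 [LHS]mul1r; congr (_%:R : F); congr nat_of_bool.
  apply/forall_inP/eqP => [cupT'|->] //=; last first.
    by move=> v vT; rewrite (relabelE _ _ vT (rT v vT)) perm1.
  apply/val_inj/eqP; rewrite eqEcard Tp T'p leqnn andbT.
  apply/subsetP => v vT'; have := cupT' v vT'; apply: contraTT => vT.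
  by rewrite lab_relabel0 // cE (negPf vT).
rewrite [LHS]mulrC; suff /negPf-> : ~~ cup (val T') (relabel s c) by rewrite mul0r.
apply: contra s1 => /forall_inP cupT'.
have TT' : val T' = val T.
  apply/eqP; rewrite eqEcard Tp T'p leqnn andbT.
  apply/subsetP => v vT'; have := cupT' v vT'; apply: contraTT => vT.
  by rewrite lab_relabel0 // cE (negPf vT).
apply/eqP/permP => i; rewrite perm1; apply/val_inj/eqP.
have [|v vT rv] := @rank_in_onto _ (val T) i; first by rewrite Tp.
have := cupT' v; rewrite TT' => /(_ vT); rewrite (relabelE _ _ vT (rT v vT)) eqSS.
have -> : Ordinal (rT v vT) = i by apply/val_inj.
by rewrite rv.
Qed.

(** The map [cups] kills the boundaries and sends the cycles onto a space whose dimension is the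
    binomial. *)
Lemma dim_cycles_ge p : (p < #|~: S|)%N ->
  (\dim (limg (bd F S p)) + 'C(#|~: S|, p) <= \dim (cycles p))%N.
Proof.
move=> pS; rewrite -(limg_ker_dim (cups p) (cycles p)) leq_add //.
  apply/dimvS/subvP => _ /memv_imgP[x _ ->]; rewrite memv_cap.
  rewrite (subvP (boundaries_sub_cycles p)) ?memv_img ?memvf //.
  by rewrite /= memv_ker -comp_lfunE cups_bd zero_lfunE.
suff -> : (cups p @: cycles p)%VS = fullv.
  rewrite dim_freev card_sig -cards_draws.
  by apply/eq_leq/eq_card => T; rewrite !inE.
apply/eqP; rewrite eqEsubv subvf /=; apply/subvP => x _.
rewrite (freev_decomp x) memv_suml // => T _; apply: memvZ.
have [c <-] := cups_antisym T pS.
by rewrite memv_img // antisym_in_cycles.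
Qed.

Lemma dim_cell_homology p : (p < #|~: S|)%N ->
  \dim (cycles p) = (\dim (limg (bd F S p)) + 'C(#|~: S|, p))%N.
Proof. by move=> pS; apply/eqP; rewrite eqn_leq dim_cycles_le dim_cycles_ge. Qed.

End CellHomology.

(** * From classes to label functions *)

Section Blocks.
Variable n : nat.
Local Open Scope nat_scope.
Implicit Types (h : 'I_n -> nat) (s : seq {set 'I_n}).

Definition blocks_of m h : seq {set 'I_n} :=
  mkseq (fun i => [set v | h v == i]) m.

Lemma size_blocks_of m h : size (blocks_of m h) = m.
Proof. exact: size_mkseq. Qed.

(** No bound on [i] is asked: from [m] on, the default [set0] is the empty fibre of [h]. *)
Lemma nth_blocks_of m h i :
  (forall v, h v < m) -> nth set0 (blocks_of m h) i = [set v | h v == i].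
Proof.
move=> hm; have [im|mi] := ltnP i m; first by rewrite nth_mkseq.
rewrite nth_default ?size_blocks_of //; apply/setP => v; rewrite !inE.
by have := hm v; lia.
Qed.

Lemma eq_blocks_of m h h' : h =1 h' -> blocks_of m h = blocks_of m h'.
Proof. by move=> hh'; apply: eq_map => i; apply/setP => v; rewrite !inE hh'. Qed.

Lemma blocks_of_inj m h h' : (forall v, h v < m) -> (forall v, h' v < m) ->
  blocks_of m h = blocks_of m h' -> h =1 h'.
Proof.
move=> hm h'm e v; have := nth_blocks_of (h v) hm.
rewrite e nth_blocks_of // => /setP/(_ v); rewrite !inE eqxx.
by move/eqP.
Qed.

Lemma size_merge_at s i : i.+1 < size s -> size (merge_at i s) = (size s).-1.
Proof.
move=> si; rewrite /merge_at size_cat size_takel; last by lia.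
by rewrite /= size_drop; lia.
Qed.

Lemma nth_merge_at s i j : i < size s -> nth set0 (merge_at i s) j =
  if j < i then nth set0 s j else
  if j == i then nth set0 s i :|: nth set0 s i.+1 else nth set0 s j.+1.
Proof.
move=> si; rewrite nth_cat (size_takel (ltnW si)); case: ltngtP => [ji|ij|->].
- by rewrite nth_take.
- by rewrite -[j - i]prednK ?subn_gt0 //= nth_drop; congr nth; lia.
- by rewrite subnn.
Qed.

Lemma size_merge_ends s : 1 < size s -> size (merge_ends s) = (size s).-1.
Proof. by move=> s1; rewrite /= size_behead size_takel; lia. Qed.

Lemma nth_merge_ends s j : j.+1 < size s -> nth set0 (merge_ends s) j =
  if j == 0 then nth set0 s 0 :|: nth set0 s (size s).-1 else nth set0 s j.
Proof.
by case: j => [|j] js; rewrite /= ?nth0 ?nth_last // nth_behead nth_take //; lia.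
Qed.

Lemma merge_at_blocks p h i : (forall v, h v < p.+2) -> i < p.+1 ->
  merge_at i (blocks_of p.+2 h) = blocks_of p.+1 (merge_label p i \o h).
Proof.
move=> hp ip.
have hp' v : (merge_label p i \o h) v < p.+1 by apply: merge_label_le; apply: hp.
apply: (@eq_from_nth _ set0) => [|j _].
  by rewrite size_merge_at !size_blocks_of.
rewrite nth_merge_at ?size_blocks_of ?(ltnW (ip : i.+1 < p.+2)) // !nth_blocks_of //.
apply/setP => v; have := hp v.
by case: (ltngtP j i) => [ji|ij|->]; rewrite !inE /=; merge_lia.
Qed.

(** The cyclic merge is the case [i = p.+1] of [merge_label]. *)
Lemma merge_ends_blocks p h : (forall v, h v < p.+2) ->
  merge_ends (blocks_of p.+2 h) = blocks_of p.+1 (merge_label p p.+1 \o h).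
Proof.
move=> hp.
have hp' v : (merge_label p p.+1 \o h) v < p.+1.
  by apply: merge_label_le; apply: hp.
apply: (@eq_from_nth _ set0) => [|j]; first by rewrite size_merge_ends !size_blocks_of.
rewrite size_merge_ends size_blocks_of // => jp.
rewrite nth_merge_ends !size_blocks_of // !nth_blocks_of //.
apply/setP => v; have := hp v.
by case: eqP => [->|j0]; rewrite !inE /=; merge_lia.
Qed.

Lemma blocks_of_partition m h : (forall v, h v < m) ->
  (forall i, i < m -> exists v, h v = i) -> ordered_set_partition (blocks_of m h).
Proof.
move=> hm honto; apply/andP; split.
  rewrite map_inj_in_uniq ?iota_uniq // => i j; rewrite !mem_iota /= add0n => im jm.
  by have [v hv] := honto i im; move/setP/(_ v); rewrite !inE hv eqxx => /esym/eqP.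
have inB (B : {set 'I_n}) :
    reflect (exists2 i, i < m & B = [set v | h v == i]) (B \in [set:: blocks_of m h]).
  rewrite inE; apply: (iffP mapP) => [[i]|[i im ->]]; last first.
    by exists i; rewrite // mem_iota.
  by rewrite mem_iota => im ->; exists i.
apply/and3P; split.
- rewrite eqEsubset subsetT; apply/subsetP => v _; apply/bigcupP.
  exists [set u | h u == h v]; last by rewrite inE.
  by apply/inB; exists (h v).
- apply/trivIsetP => _ _ /inB[i im ->] /inB[j jm ->] ij.
  rewrite -setI_eq0; apply: contra_neqT ij => /set0Pn[v]; rewrite !inE.
  by move=> /andP[/eqP<- /eqP<-].
- apply/negP => /inB[i im /setP e]; have [v hv] := honto i im.
  by have := e v; rewrite !inE hv eqxx.
Qed.

Lemma partition_blocks_of s : ordered_set_partition s ->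
  exists h, [/\ forall v, h v < size s, forall i, i < size s -> exists v, h v = i
    & s = blocks_of (size s) h].
Proof.
case/andP => us /and3P[/eqP cov /trivIsetP triv n0].
pose h v := find (fun B : {set 'I_n} => v \in B) s.
have hs v : h v < size s.
  rewrite -has_find; have : v \in cover [set:: s] by rewrite cov inE.
  by case/bigcupP => B; rewrite inE => Bs vB; apply/hasP; exists B.
have hE v i : i < size s -> (h v == i) = (v \in nth set0 s i).
  move=> is_; have vh : v \in nth set0 s (h v).
    by have := hs v; rewrite -has_find => /(nth_find set0).
  apply/eqP/idP => [<- //|vi]; apply/eqP; rewrite -(nth_uniq set0 _ _ us) //.
  apply: contraTT vi => neq; have := triv _ _ _ _ neq.
  by rewrite !inE !mem_nth // => /(_ isT isT)/disjointFr ->.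
exists h; split => // [i is_|].
  have : nth set0 s i != set0.
    by apply: contraNneq n0 => <-; rewrite inE mem_nth.
  by case/set0Pn => v; rewrite -hE // => /eqP; exists v.
apply: (@eq_from_nth _ set0) => [|i is_]; first by rewrite size_blocks_of.
by rewrite nth_blocks_of //; apply/setP => v; rewrite inE hE.
Qed.

End Blocks.

(** * Rotation of block labels and its signs *)

Section Rotation.
Local Open Scope nat_scope.

(** For [a] and [x] at most [p], this is [x - a] modulo [p.+1]. *)
Definition rot_label (p a x : nat) : nat :=
  if a <= x then x - a else x + p.+1 - a.

Lemma rot_label_le p a x : a <= p -> x <= p -> rot_label p a x <= p.
Proof. by move=> ap xp; rewrite /rot_label; case: (leqP a x); lia. Qed.

Lemma rot_label_inj p a x y : a <= p -> x <= p -> y <= p ->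
  rot_label p a x = rot_label p a y -> x = y.
Proof.
by move=> ap xp yp; rewrite /rot_label; case: (leqP a x); case: (leqP a y); lia.
Qed.

(** [rot_label p a 0] is [- a] modulo [p.+1], so the outer rotation undoes the inner one. *)
Lemma rot_labelK p a x : a <= p -> x <= p ->
  rot_label p (rot_label p a 0) (rot_label p a x) = x.
Proof.
rewrite /rot_label leqn0; case: (posnP a) => [->|a0] ap xp; first by rewrite !subn0.
case: (leqP a x) => ax; first by case: (leqP (0 + p.+1 - a) (x - a)); lia.
by case: (leqP (0 + p.+1 - a) (x + p.+1 - a)); lia.
Qed.

(** Rotation commutes with merging once the merge position is rotated too and the origin [a] is
    replaced by its merged label. *)
Lemma merge_rot_label p a x i : a <= p.+1 -> x <= p.+1 -> i <= p.+1 ->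
  merge_label p (rot_label p.+1 a i) (rot_label p.+1 a x) =
  rot_label p (merge_label p i a) (merge_label p i x).
Proof.
move=> ap xp ip.
case: (merge_labelP p i a) => [ai ap'|ai|a' ai aE];
case: (merge_labelP p i x) => [xi xp'|xi|x' xi xE];
by rewrite /rot_label; do ?case: leqP => ?; merge_lia.
Qed.

(** The parity identity that makes [cell_class], with its sign, commute with the boundaries. *)
Lemma sign_rot_label (R : pzRingType) p a i : a <= p.+1 -> i <= p.+1 ->
  ((-1) ^+ (p.+1 * a) * (-1) ^+ rot_label p.+1 a i =
   (-1) ^+ i * (-1) ^+ (p * merge_label p i a) :> R)%R.
Proof.
move=> ap ip; rewrite -!exprD -signr_odd -[RHS]signr_odd; congr (_ ^+ nat_of_bool _)%R.
rewrite /rot_label; case: (merge_labelP p i a) => [ai ap'|ai|a' ai aE].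
- rewrite ai mulSn addnAC subnKC // oddD [RHS]oddD; lia.
- have [-> ->] : a = p.+1 /\ i = p.+1 by lia.
  by rewrite leqnn subnn muln0 !addn0 oddM andbb.
- rewrite ifN aE -?ltnNge ?ltnS // mulSn mulnS !oddD oddB ?oddD /=; last by lia.
  by rewrite oddM; case: (odd i) (odd p) (odd a') => [] [] [].
Qed.
End Rotation.

(** * The isomorphism between the cell complex and the cyclic coloring complex of a star *)

Section StarHypergraph.
Variables (n : nat) (E : {set {set 'I_n}}) (S : {set 'I_n}) (v1 : 'I_n).
Hypothesis v1_0 : val v1 = 0%N.
Hypothesis edges_cover : forall v : 'I_n, exists2 e, e \in E & v \in e.
Hypothesis edge_size : forall e, e \in E -> #|e| = #|S|.+1.
Hypothesis edge_sub : forall e, e \in E -> S \subset e.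
Hypothesis S_neq0 : S != set0.

(** Blocks counted from the one of [v1], as in the chosen representative of a class, rather than
    from the one of [S]. *)
Definition vlabel p (c : cell S p) (v : 'I_n) : nat :=
  rot_label p (lab c v1) (lab c v).

Lemma vlabel_lt p (c : cell S p) v : (vlabel c v < p.+1)%N.
Proof. by rewrite ltnS rot_label_le ?lab_le. Qed.

(** A hyperedge is [S] and one more vertex; as the hyperedges cover, every [v |: S] with [v] outside
    [S] is one. *)
Lemma contains_edgeP (B : {set 'I_n}) :
  reflect (S \subset B /\ exists2 v, v \notin S & v \in B)
    [exists e in E, e \subset B].
Proof.
apply: (iffP exists_inP) => [[e eE eB]|[SB [v vS vB]]].
  split; first exact: subset_trans (edge_sub eE) eB.
  have : (0 < #|e :\: S|)%N by rewrite cardsDS ?edge_sub // edge_size // subSnn.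
  by case/card_gt0P => v; rewrite inE => /andP[vS ve]; exists v; rewrite ?(subsetP eB).
have [e eE ve] := edges_cover v; exists e => //.
suff -> : e = v |: S by rewrite subUset sub1set vB.
apply/eqP; rewrite eq_sym eqEcard subUset sub1set ve edge_sub //=.
by rewrite edge_size // cardsU1 vS.
Qed.

Fact class_of_subproof p (c : cell S p) :
  {t : cyc_class E p.+1 | blocks t = blocks_of p.+1 (vlabel c) :> seq _}.
Proof.
have sz : size (blocks_of p.+1 (vlabel c)) == p.+1 by rewrite size_blocks_of.
suff tP : [&& ordered_set_partition (blocks_of p.+1 (vlabel c)),
    some_block_has_edge E (blocks_of p.+1 (vlabel c))
    & vertex1_in_first (blocks_of p.+1 (vlabel c))].
  by exists (@CycClass _ _ _ (Tuple sz) tP).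
apply/and3P; split.
- apply: blocks_of_partition => [v|i]; first exact: vlabel_lt.
  rewrite ltnS => ip.
  have [v _ cv] : exists2 v, v \notin S &
      lab c v = rot_label p (rot_label p (lab c v1) 0) i.
    by apply: lab_onto; rewrite !rot_label_le ?lab_le.
  exists v; apply: (@rot_label_inj p (rot_label p (lab c v1) 0)).
  + by rewrite rot_label_le ?lab_le.
  + by rewrite -ltnS vlabel_lt.
  + by [].
  + by rewrite rot_labelK ?lab_le.
- apply/hasP; exists [set v | vlabel c v == rot_label p (lab c v1) 0]%N.
    apply/mapP; exists (rot_label p (lab c v1) 0) => //.
    by rewrite mem_iota /= add0n ltnS rot_label_le ?lab_le.
  apply/contains_edgeP; split.
    by apply/subsetP => v vS; rewrite inE /vlabel (lab_base c vS).
  by have [v vS cv] := lab_onto c (leq0n p); exists v; rewrite // inE /vlabel cv.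
- apply/existsP; exists v1; rewrite v1_0 eqxx andbT -nth0 nth_blocks_of.
    by rewrite inE /vlabel /rot_label leqnn subnn.
  exact: vlabel_lt.
Qed.

Definition class_of p (c : cell S p) : cyc_class E p.+1 :=
  sval (class_of_subproof c).

Lemma blocks_class_of p (c : cell S p) :
  blocks (class_of c) = blocks_of p.+1 (vlabel c) :> seq _.
Proof. exact: (svalP (class_of_subproof c)). Qed.

Lemma class_of_inj p : injective (@class_of p).
Proof.
move=> c d cd.
have lE : vlabel c =1 vlabel d.
  apply: (@blocks_of_inj _ p.+1); try exact: vlabel_lt.
  by rewrite -!blocks_class_of cd.
(* A vertex of [S] has cell label 0, so its [vlabel] reveals the rotation [lab c v1]. *)
have [s sS] := set0Pn _ S_neq0.
have cs : lab c s = 0%N by apply: lab_base.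
have ds : lab d s = 0%N by apply: lab_base.
have aE : lab c v1 = lab d v1.
  have := lE s; rewrite /vlabel cs ds.
  have := lab_le c v1; have := lab_le d v1; rewrite /rot_label.
  by do ?case: ifP; lia.
apply: lab_inj => v; apply: (@rot_label_inj p (lab c v1)); rewrite ?lab_le //.
by have := lE v; rewrite /vlabel aE.
Qed.

Lemma class_of_onto p (t : cyc_class E p.+1) : exists c : cell S p, class_of c = t.
Proof.
have /and3P[part edge first_v1] := valP t.
have [h [hp honto tE]] := partition_blocks_of part.
rewrite size_tuple in hp honto tE.
have h1 : h v1 = 0%N.
  case/existsP: first_v1 => v /andP[]; rewrite [val t]/= tE -nth0 nth_blocks_of //.
  rewrite inE => /eqP hv /eqP v_0.
  by rewrite (_ : v1 = v) //; apply/val_inj; rewrite v1_0.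
have [s sS] := set0Pn _ S_neq0.
(* The block with a hyperedge contains [S], so it is block [h s]; rotating by [h s] makes it block
   0. *)
have [Sh [w wS hw]] : (forall v, v \in S -> h v = h s) /\
    exists2 w, w \notin S & h w = h s.
  case/hasP: edge => B; rewrite [val t]/= tE.
  move=> /mapP[i _ ->] /contains_edgeP[/subsetP SB].
  have := SB s sS; rewrite inE => /eqP-> [w wS]; rewrite inE => /eqP hw.
  split=> [v /SB|]; first by rewrite inE => /eqP.
  by exists w.
have hle v : (h v <= p)%N by rewrite -ltnS.
have hK v : rot_label p (rot_label p (h s) 0) (rot_label p (h s) (h v)) = h v.
  by rewrite rot_labelK // -ltnS.
have [c cE] : {c : cell S p | lab c =1 fun v => rot_label p (h s) (h v)}.
  apply: cell_of_lab => [v|v vS|j jp].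
  - by rewrite rot_label_le ?hle.
  - by rewrite Sh // /rot_label leqnn subnn.
  - have [j0|j0] := posnP j.
      by exists w; rewrite // hw j0 /rot_label leqnn subnn.
    have [|v hv] := honto (rot_label p (rot_label p (h s) 0) j).
      by rewrite ltnS !rot_label_le ?hle.
    have vj : rot_label p (h s) (h v) = j.
      apply: (@rot_label_inj p (rot_label p (h s) 0)); rewrite ?rot_label_le ?hle //.
      by rewrite hK hv.
    exists v => //; apply: contraTN j0 => /Sh hvs; rewrite -vj hvs.
    by rewrite /rot_label leqnn subnn.
exists c; apply/val_inj/val_inj => /=.
rewrite blocks_class_of tE; apply: eq_blocks_of => v.
by rewrite /vlabel !cE h1 hK.
Qed.

Lemma class_of_bij p : bijective (@class_of p).
Proof.
apply: inj_card_bij (@class_of_inj p) _.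
rewrite -(card_codom (@class_of_inj p)).
by apply/subset_leq_card/subsetP => t _; have [c <-] := class_of_onto t; apply: codom_f.
Qed.

Variable F : fieldType.

(* Bringing the block of v1 to the front rotates the p.+1 blocks by a = lab c v1
   places, and each rotation by one place has the sign (-1)^p. *)
Definition cell_class p :
    'Hom(freev F (cell S p), freev F (cyc_class E p.+1)) :=
  linext (fun c => (-1) ^+ (p * lab c v1) *: bvec (class_of c)).

Lemma class_vect_blocks m (t : cyc_class E m) :
  class_vect F E m t = bvec t :> chain F E m.
Proof. by apply/ffunP => u; rewrite !ffunE. Qed.

Lemma class_vect_face p (c : cell S p.+1) (i : nat) : (i < p.+2)%N ->
  class_vect F E p.+1 (blocks_of p.+1
    (merge_label p (rot_label p.+1 (lab c v1) i) \o vlabel c))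
  = bvec (class_of (face i c)) :> chain F E p.+1.
Proof.
move=> ip; rewrite -class_vect_blocks blocks_class_of; congr class_vect.
apply: eq_blocks_of => v; rewrite /= /vlabel !lab_face.
by rewrite merge_rot_label ?lab_le.
Qed.

Lemma boundary_class_of p (c : cell S p.+1) :
  boundary_class F (class_of c) =
  \sum_(i < p.+2) (-1) ^+ rot_label p.+1 (lab c v1) i *: bvec (class_of (face i c)).
Proof.
have hlt v := vlabel_lt c v.
pose G i : chain F E p.+1 :=
  (-1) ^+ i *: class_vect F E p.+1 (blocks_of p.+1 (merge_label p i \o vlabel c)).
have -> : boundary_class F (class_of c) = \sum_(i < p.+2) G i.
  rewrite big_ord_recr /boundary_class /= blocks_class_of; congr (_ + _).
    apply: eq_bigr => i _; rewrite merge_at_blocks //.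
    by rewrite !exprS !mulN1r opprK.
  by rewrite /G merge_ends_blocks // !exprS !mulN1r opprK.
(* Face [i] of the cell is the merge of the class at the rotated position. *)
pose r (i : 'I_p.+2) : 'I_p.+2 := inord (rot_label p.+1 (lab c v1) i).
have rE i : r i = rot_label p.+1 (lab c v1) i :> nat.
  by rewrite inordK // ltnS rot_label_le ?lab_le // -ltnS.
have r_inj : injective r.
  move=> i j ij; apply/val_inj/(@rot_label_inj p.+1 (lab c v1)).
  - exact: lab_le.
  - exact: (ltn_ord i).
  - exact: (ltn_ord j).
  - by rewrite -!rE ij.
rewrite (reindex_inj r_inj) /=.
by apply: eq_bigr => i _; rewrite rE /G class_vect_face.
Qed.

(** The rotated merge position and the changed label of [v1] both alter the sign; [sign_rot_label]
    balances them. *)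
Lemma boundary_cell_class p :
  (boundary F E p.+1 \o cell_class p.+1)%VF = (cell_class p \o bd F S p)%VF.
Proof.
apply: lfun_bvecP => c; rewrite !comp_lfunE !linext_bvec linearZ /=.
have -> : boundary F E p.+1 (bvec (class_of c)) = boundary_class F (class_of c).
  exact: (@linext_bvec F _ _ (@boundary_class F n E p.+1)).
rewrite boundary_class_of scaler_sumr linear_sum; apply: eq_bigr => i _ /=.
rewrite [cell_class p _]linearZ /= /cell_class linext_bvec !scalerA lab_face.
by congr (_ *: _); rewrite sign_rot_label ?lab_le // -ltnS.
Qed.

Lemma cell_class_iso p : lker (cell_class p) = 0%VS /\ limg (cell_class p) = fullv.
Proof.
by apply: linext_bij (class_of_bij p) _ => c; rewrite signr_eq0.
Qed.

Lemma limg_boundary p :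
  limg (boundary F E p.+1) = (cell_class p @: limg (bd F S p))%VS.
Proof.
have [_ full] := cell_class_iso p.+1.
by rewrite -limg_comp -boundary_cell_class limg_comp full.
Qed.

Lemma lker_boundary p :
  lker (boundary F E p) = (cell_class p @: cycles F S p)%VS.
Proof.
have [_ full] := cell_class_iso p.
case: p full => [|p] full.
  rewrite /= full boundary0; apply/eqP; rewrite eqEsubv subvf.
  by apply/subvP => x _; rewrite memv_ker zero_lfunE.
have [inj0 _] := cell_class_iso p.
have key x : (boundary F E p.+1 (cell_class p.+1 x) == 0) = (bd F S p x == 0).
  rewrite -comp_lfunE boundary_cell_class comp_lfunE -!memv_ker inj0.
  by rewrite memv0 memv_ker.
apply/eqP; rewrite eqEsubv; apply/andP; split; apply/subvP => y.
  have /memv_imgP[x _ ->] : y \in limg (cell_class p.+1) by rewrite full memvf.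
  by rewrite memv_ker key => bx; rewrite memv_img //= memv_ker.
by case/memv_imgP => x; rewrite /= memv_ker => bx ->; rewrite memv_ker key.
Qed.

Lemma dim_star_homology p : [pchar F] =i pred0 -> (p < #|~: S|)%N ->
  \dim (lker (boundary F E p) :\: limg (boundary F E p.+1)) = 'C(#|~: S|, p).
Proof.
move=> charF0 pS; rewrite lker_boundary limg_boundary.
have [inj0 _] := cell_class_iso p.
have dimE U : \dim (cell_class p @: U) = \dim U by rewrite limg_dim_eq // inj0 capv0.
have := dimv_cap_compl (cell_class p @: cycles F S p) (cell_class p @: limg (bd F S p)).
have /capv_idPr-> := limgS (cell_class p) (boundaries_sub_cycles F S p).
by rewrite !dimE dim_cell_homology // => /addnI.
Qed.

End StarHypergraph.

Theorem theorem4p1 (F : fieldType) (charF0 : [pchar F] =i pred0)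
    (n k : nat) (E : {set {set 'I_n}})
    (k_ge2 : (2 <= k)%N) (starE : star_hypergraph k E)
    (r : int) (r_bounds : -1 <= r <= n%:Z - k%:Z - 1) :
  \dim {: HC F E r} = 'C(n - k + 1, `|(r + 1)%R|%N).
Proof.
have [sizeE coverE [S Sk SE]] := starE.
(* The centre has [k - 1] vertices, at least one since [k >= 2]. *)
have [s sS] : exists s, s \in S by apply/card_gt0P; lia.
have n_gt0 : (0 < n)%N by apply: leq_ltn_trans (ltn_ord s).
have [e eE _] := coverE s.
have kn : (k <= n)%N by rewrite -(sizeE e eE) -[n in (_ <= n)%N]card_ord max_card.
have cardW : #|~: S| = (n - k + 1)%N.
  by have := cardsC S; rewrite card_ord; lia.
rewrite /HC dim_vquot -cardW.
apply: (dim_star_homology (v1 := Ordinal n_gt0)) => //.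
- by move=> e' /sizeE ->.
- by apply/set0Pn; exists s.
(* The upper bound on [r] gives [r + 1 <= n - k], which is below [#|~: S|]. *)
- by rewrite cardW; lia.
Qed.
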